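(* Let $G$ and $H$ be finitely generated groups where $H$ has polynomial growth of degree $d\ge 1$. Then $$\alpha_2^{\#}\Big(\bigoplus_H G\Big)\ \ge\ \frac{\alpha_2^{\#}(G)}{1+F(\alpha_2^{\#}(G),d)+2\alpha_2^{\#}(G)(1+d)},$$ where $\bigoplus_H G$ is equipped with the subspace metric from the wreath product $G\wr H$, and $F:[0,1]\times\mathbb{R}^{\ge0}\to\mathbb{R}$ is the function $$F(\alpha,d)=\begin{cases} d(2\alpha-1) & \text{if } 2\alpha\ge 1,\\ 0&\text{otherwise.}\end{cases}$$
   Context: Groups here are discrete. $\bigoplus_H G$ is the group of finitely supported functions $\mathbf{f}:H\to G$ under pointwise multiplication, and $G\wr H=(\bigoplus_H G)\rtimes H$, where $H$ acts by translation. The subspace metric on $\bigoplus_H G$ is the restriction of the word metric of the finitely generated group $G\wr H$ (with respect to the standard finite generating set given by finite generating sets of $H$ and of the copy of $G$ supported at $1\in H$); the associated length function is proper. $H$ has polynomial growth of degree $d$ if the balls of radius $n$ in a word metric have cardinality comparable, up to multiplicative constants, to $n^d$ for $n\ge 1$. A 1-cocycle associated to a unitary representation $\pi$ of a group $\Gamma$ on a Hilbert space $\mathcal{H}$ is a map $b:\Gamma\to\mathcal{H}$ with $b(gh)=\pi(g)b(h)+b(g)$ for all $g,h$. For a length function $|\cdot|$ on $\Gamma$, $b$ is large-scale Lipschitz if there are $C,D>0$ with $\|b(g)\|\le C|g|+D$ for all $g$; its compression $R(b)$ is the supremum of $r\in[0,1]$ for which there exist $C,D>0$ with $\frac1C|g|^r-D\le\|b(g)\|\le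 C|g|+D$ for all $g\in\Gamma$. For a group $\Gamma$ with a proper length function, the equivariant Hilbert space compression $\alpha_2^{\#}(\Gamma)$ is the supremum of $R(b)$ over all large-scale Lipschitz 1-cocycles of $\Gamma$ associated to unitary representations on Hilbert spaces. For a finitely generated group the word length is used (every 1-cocycle is then Lipschitz), and $\alpha_2^{\#}$ is the supremum of the compressions of the 1-cocycles of its proper affine isometric actions on Hilbert spaces (equal to $0$ if there are none). *)

(* Defs.v *)
From HB Require Import structures.
From mathcomp Require Import all_boot all_order all_algebra finmap.
From mathcomp Require Import sesquilinear.
From mathcomp Require Import all_classical all_reals all_analysis.
From mathcomp.real_closed Require Import complex.

Set Implicit Arguments.
Unset Strict Implicit.
Unset Printing Implicit Defensive.

Import Order.TTheory GRing.Theory Num.Theory.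
Import numFieldNormedType.Exports.

Local Open Scope classical_set_scope.
Local Open Scope ring_scope.

Section WordLength.
Variable G : groupType.
Implicit Types (S w : seq G) (g : G).

Definition word S w : bool := all (fun x => (x \in S) || (x^-1%g \in S)) w.

Definition in_word_ball S n g : Prop :=
  exists w, [/\ word S w, (size w <= n)%N & g = (\prod_(x <- w) x)%g].

Definition generates S : Prop := forall g, exists n, in_word_ball S n g.

Lemma in_word_ballW S g :
  (exists n, in_word_ball S n g) -> exists n, `[< in_word_ball S n g >].
Proof. by case=> n Hn; exists n; apply/asboolP. Qed.

(* The junk value 0 is never reached when S generates G. *)
Definition word_length S g : nat :=
  if pselect (exists n, in_word_ball S n g) is left h
  then ex_minn (in_word_ballW h) else 0%N.

End WordLength.

Definition polynomial_growth (R : realType) (H : groupType) (d : R) : Prop :=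
  exists T : seq H, generates T /\
  exists c C : R, [/\ 0 < c, 0 < C & forall n : nat, (1 <= n)%N ->
    let ball_card := #|` fset_set [set h | (word_length T h <= n)%N]| in
    c * n%:R `^ d <= ball_card%:R <= C * n%:R `^ d].

(* Restricted direct sum: finitely supported functions H -> G. *)
Definition dsum (H G : groupType) : Type := {fsfun H -> G with 1%g}.
HB.instance Definition _ (H G : groupType) :=
  Choice.copy (dsum H G) {fsfun H -> G with 1%g}.

Section DsumGroup.
Variables H G : groupType.
Implicit Types (f g : dsum H G) (h x : H).
Local Open Scope fset_scope.

Definition dsum_app f x : G := (f : {fsfun H -> G with 1%g}) x.
Coercion dsum_app : dsum >-> Funclass.

Definition dsum_one : dsum H G := [fsfun with 1%g].
Definition dsum_mul f g : dsum H G :=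
  [fsfun x in finsupp f `|` finsupp g => (f x * g x)%g].
Definition dsum_inv f : dsum H G := [fsfun x in finsupp f => (f x)^-1%g].

Lemma dsum_ext f g : f =1 g -> f = g.
Proof. by move=> e; apply/fsfunP. Qed.

Lemma dsum_oneE x : dsum_one x = 1%g.
Proof. by rewrite /dsum_app fsfunE. Qed.

Lemma dsum_mulE f g x : dsum_mul f g x = (f x * g x)%g.
Proof.
rewrite /dsum_mul {1}/dsum_app fsfunE inE; case: ifPn => // /norP[fx gx].
by rewrite /dsum_app !fsfun_dflt // mulg1.
Qed.

Lemma dsum_invE f x : dsum_inv f x = (f x)^-1%g.
Proof. rewrite /dsum_inv {1}/dsum_app fsfunE; case: ifPn => // fx.
by rewrite /dsum_app fsfun_dflt // invg1. Qed.

Let mulA : associative dsum_mul.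
Proof. by move=> a b c; apply: dsum_ext => x; rewrite !dsum_mulE mulgA. Qed.
Let mul1 : left_id dsum_one dsum_mul.
Proof. by move=> a; apply: dsum_ext => x; rewrite dsum_mulE dsum_oneE mul1g. Qed.
Let mulr1 : right_id dsum_one dsum_mul.
Proof. by move=> a; apply: dsum_ext => x; rewrite dsum_mulE dsum_oneE mulg1. Qed.
Let mulV : left_inverse dsum_one dsum_inv dsum_mul.
Proof.
by move=> a; apply: dsum_ext => x; rewrite dsum_mulE dsum_invE dsum_oneE mulVg.
Qed.
Let mulrV : right_inverse dsum_one dsum_inv dsum_mul.
Proof.
by move=> a; apply: dsum_ext => x; rewrite dsum_mulE dsum_invE dsum_oneE mulgV.
Qed.

HB.instance Definition _ :=
  isGroup.Build (dsum H G) mulA mul1 mulr1 mulV mulrV.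

Definition dsum_translate h f : dsum H G :=
  [fsfun x in [fset (h * y)%g | y in finsupp f] => f (h^-1 * x)%g].

Lemma dsum_translateE h f x : dsum_translate h f x = f (h^-1 * x)%g.
Proof.
rewrite /dsum_translate {1}/dsum_app fsfunE; case: ifPn => // xN.
rewrite /dsum_app fsfun_dflt //; apply: contra xN => xf.
by apply/imfsetP; exists (h^-1 * x)%g; rewrite //= mulVKg.
Qed.

Definition dsum_delta (g : G) : dsum H G :=
  [fsfun [fsfun with 1%g] with 1%g |-> g].

End DsumGroup.

(* Wreath product G wr H, as a type distinct from the product dsum H G * H,
   which already carries the direct product group structure. *)
Record wreath (G H : groupType) : Type :=
  Wreath { wr_fun : dsum H G; wr_pos : H }.

Section WreathGroup.
Variables G H : groupType.
Implicit Types u v : wreath G H.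

Definition wr_pair u := (wr_fun u, wr_pos u).
Definition pair_wr (p : dsum H G * H) : wreath G H := Wreath p.1 p.2.
Lemma wr_pairK : cancel wr_pair pair_wr. Proof. by case. Qed.
HB.instance Definition _ := Choice.copy (wreath G H) (can_type wr_pairK).

Definition wr_one : wreath G H := Wreath 1%g 1%g.
Definition wr_mul u v : wreath G H :=
  Wreath (wr_fun u * dsum_translate (wr_pos u) (wr_fun v))%g
         (wr_pos u * wr_pos v)%g.
Definition wr_inv u : wreath G H :=
  Wreath (dsum_translate (wr_pos u)^-1%g (wr_fun u)^-1%g) (wr_pos u)^-1%g.

Lemma wr_ext u v : wr_fun u =1 wr_fun v -> wr_pos u = wr_pos v -> u = v.
Proof. by case: u v => [f h] [g k] /= /dsum_ext -> ->. Qed.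

Let E := (dsum_translateE, dsum_mulE, dsum_oneE, dsum_invE).

Let mulA : associative wr_mul.
Proof.
move=> a b c; apply: wr_ext => [x|] /=; last exact: mulgA.
by rewrite !E invgM !mulgA.
Qed.
Let mul1 : left_id wr_one wr_mul.
Proof.
move=> a; apply: wr_ext => [x|] /=; last exact: mul1g.
by rewrite !E invg1 !mul1g.
Qed.
Let mulr1 : right_id wr_one wr_mul.
Proof.
move=> a; apply: wr_ext => [x|] /=; last exact: mulg1.
by rewrite !E mulg1.
Qed.
Let mulV : left_inverse wr_one wr_inv wr_mul.
Proof.
move=> a; apply: wr_ext => [x|] /=; last exact: mulVg.
by rewrite !E mulVg.
Qed.
Let mulrV : right_inverse wr_one wr_inv wr_mul.
Proof.
move=> a; apply: wr_ext => [x|] /=; last exact: mulgV.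
by rewrite !E invgK mulVKg mulgV.
Qed.

HB.instance Definition _ :=
  isGroup.Build (wreath G H) mulA mul1 mulr1 mulV mulrV.

Definition wreath_gens (SG : seq G) (SH : seq H) : seq (wreath G H) :=
  [seq Wreath (dsum_delta H g) 1%g | g <- SG] ++
  [seq Wreath 1%g h | h <- SH].

Definition wreath_sublength (SG : seq G) (SH : seq H) (f : dsum H G) : nat :=
  word_length (wreath_gens SG SH) (Wreath f 1%g).

End WreathGroup.

Record hilbertSpace (R : realType) := HilbertSpace {
  hilbert_sort :> completeNormedModType R[i];
  dotp : {dot hilbert_sort for Num.conj};
  dotp_norm : forall v : hilbert_sort, `|v| ^+ 2 = dotp v v }.

(* The norm of a normed R[i]-module is R[i]-valued (and nonnegative, hence
   real); hnorm is the same norm seen in R. *)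
Definition hnorm (R : realType) (E : hilbertSpace R) (v : E) : R :=
  complex.Re `|v|.

Section Compression.
Variables (R : realType) (Gam : groupType).

Section Cocycle.
Variable E : hilbertSpace R.
Implicit Types (pi : Gam -> {linear E -> E}) (b : Gam -> E) (len : Gam -> R).

Definition unitary_representation pi : Prop :=
  [/\ forall v, pi 1%g v = v,
      forall g h v, pi (g * h)%g v = pi g (pi h v)
    & forall g u v, dotp E (pi g u) (pi g v) = dotp E u v].

Definition cocycle pi b : Prop :=
  forall g h, b (g * h)%g = pi g (b h) + b g.

Definition affine_action pi b (g : Gam) (v : E) : E := pi g v + b g.

(* Metric properness: only finitely many g move some point of a given bounded
   set into that set. *)
Definition proper_action (act : Gam -> E -> E) : Prop :=
  forall M : R,
    finite_set [set g | exists v, hnorm v <= M /\ hnorm (act g v) <= M].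

Definition large_scale_lipschitz len b : Prop :=
  exists C D : R, [/\ 0 < C, 0 < D & forall g, hnorm (b g) <= C * len g + D].

Definition compression len b : R :=
  sup [set r : R | 0 <= r <= 1 /\
    exists C D : R, [/\ 0 < C, 0 < D & forall g,
      C^-1 * len g `^ r - D <= hnorm (b g) <= C * len g + D]].

End Cocycle.

Definition equivariant_compression (len : Gam -> R) : R :=
  sup [set r : R | exists (E : hilbertSpace R) (pi : Gam -> {linear E -> E})
      (b : Gam -> E),
    [/\ unitary_representation pi, cocycle pi b,
        large_scale_lipschitz len b & r = compression len b]].

(* S is a finite generating set of Gam. Every cocycle is Lipschitz for the word
   length, and sup set0 = 0 covers the absence of proper actions. *)
Definition fg_equivariant_compression (S : seq Gam) : R :=
  sup [set r : R | exists (E : hilbertSpace R) (pi : Gam -> {linear E -> E})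
      (b : Gam -> E),
    [/\ unitary_representation pi, cocycle pi b,
        proper_action (affine_action pi b)
      & r = compression (fun g => (word_length S g)%:R) b]].

End Compression.

Definition F (R : realType) (alpha d : R) : R :=
  if 1 <= 2 * alpha then d * (2 * alpha - 1) else 0.

(* Main.v *)
(* Let b be a cocycle of G and 0 < r <= 1/2 with |g|^r bounded by |b(g)| up to
   affine constants. Attach to each h in H the cocycle of G
     g |-> (b(g), sqrt(1 + |h|) (delta_g - delta_1))  in  E (+) l2(G),
   and let B be the l2(H)-direct sum of these, a cocycle of the direct sum with
     |B(f)|^2 = sum_(h in supp f) (|b(f h)|^2 + 2 (1 + |h|)).
   - A word of length n for f visits every point of supp f, so supp f lies in
     the ball of radius n and sum_h |f h| <= n; hence |B(f)| is O(n).
   - Conversely |f| <= sum_(h in supp f) (|f h| + 2 |h|). Since 2 r <= 1,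
     t |-> t^(2 r) is subadditive, and |f|^(2 r) is O(|B(f)|^2).
   So every r < alpha with r <= 1/2 is attained. For d >= 1 the bound of the
   theorem is such an r: its denominator is at least 1 + 4 alpha. *)

Require Import Defs.
From HB Require Import structures.
From mathcomp Require Import all_boot all_order all_algebra finmap.
From mathcomp Require Import sesquilinear ring lra.
From mathcomp Require Import all_classical all_reals all_analysis.
From mathcomp.real_closed Require Import complex.

Set Implicit Arguments.
Unset Strict Implicit.
Unset Printing Implicit Defensive.
Import Order.TTheory GRing.Theory Num.Theory.
Import numFieldNormedType.Exports.
Local Open Scope classical_set_scope.
Local Open Scope ring_scope.

(** * Unordered sums of real families *)

Section UnorderedSum.
Variables (R : realType) (I : choiceType).
Implicit Types (a b : I -> R) (A B : {fset I}).

(** Unconditional summation: limits run along the finite subsets ordered by inclusion, so a sum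
    depends on no enumeration of [I], which may be uncountable. *)
Definition fsets_eventually : set_system {fset I} :=
  filter_from setT (fun A => [set B | (A `<=` B)%fset]).

#[global] Instance fsets_eventually_filter : ProperFilter fsets_eventually.
Proof.
apply: filter_from_proper; last by move=> A _; exists A; apply: fsubset_refl.
apply: filter_fromT_filter; first by exists fset0.
by move=> A B; exists (A `|` B)%fset => C /=; rewrite fsubUset => /andP[].
Qed.

Definition fset_sum a A : R := \sum_(i <- A) a i.

Definition usum a : R := lim (fset_sum a @ fsets_eventually).

Definition usummable a := exists M, forall A, \sum_(i <- A) `|a i| <= M.

Lemma ler_sum_fsubset a A B : (forall i, 0 <= a i) -> (A `<=` B)%fset ->
  \sum_(i <- A) a i <= \sum_(i <- B) a i.
Proof.
move=> a0 AB; rewrite (big_fsetID _ [in A] B) /=.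
rewrite (_ : [fset x in B | x \in A]%fset = A) ?lerDl ?sumr_ge0//.
apply/fsetP => i; rewrite !inE andbC.
by case: (boolP (i \in A)) => // /(fsubsetP AB) ->.
Qed.

Lemma le_usummable a b : (forall i, `|a i| <= b i) -> usummable b -> usummable a.
Proof.
move=> ab [M bM]; exists M => A; apply: le_trans (bM A).
by apply: ler_sum => i _; apply: le_trans (ab i) (ler_norm _).
Qed.

Lemma usummableD a b :
  usummable a -> usummable b -> usummable (fun i => a i + b i).
Proof.
move=> [M aM] [N bN]; exists (M + N) => A; apply: le_trans (lerD (aM A) (bN A)).
by rewrite -big_split; apply: ler_sum => i _; apply: ler_normD.
Qed.

Lemma usummableZ c a : usummable a -> usummable (fun i => c * a i).
Proof.
move=> [M aM]; exists (`|c| * M) => A.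
apply: le_trans (ler_wpM2l (normr_ge0 c) (aM A)).
by rewrite mulr_sumr; apply: ler_sum => i _; rewrite normrM.
Qed.

(** A nonnegative family converges to the supremum of its partial sums; in general [a] is the
    difference of the nonnegative families [a + |a|] and [|a|]. *)
Lemma usum_is_cvg a :
  usummable a -> cvg (fset_sum a @ fsets_eventually).
Proof.
have ge0_cvg b : (forall i, 0 <= b i) -> usummable b ->
    cvg (fset_sum b @ fsets_eventually).
  move=> b0 [M bM]; pose P := range (fun A => \sum_(i <- A) b i).
  have bM' A : \sum_(i <- A) b i <= M.
    by apply: le_trans (bM A); apply: ler_sum => i _; apply: ler_norm.
  have P_sup : has_sup P.
    by split; [exists (\sum_(i <- fset0) b i), fset0 | exists M => _ [A _ <-]].
  apply/cvg_ex; exists (sup P); apply/cvgrPdist_le => /= e e0.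
  have [_ [A _ <-] Ae] := sup_adherent e0 P_sup.
  exists A => // B /= AB.
  have Ble : \sum_(i <- B) b i <= sup P.
    by apply: ub_le_sup; [case: P_sup | exists B].
  rewrite ger0_norm ?subr_ge0// lerBlDr -lerBlDl.
  by apply: le_trans (ler_sum_fsubset b0 AB); apply: ltW.
move=> [M aM]; have a_abs : usummable (fun i => `|a i|).
  by exists M => A; under eq_bigr do rewrite normr_id.

have -> : fset_sum a =
    fset_sum (fun i => a i + `|a i|) \- fset_sum (fun i => `|a i|).
  by apply/funext => A; rewrite /fset_sum /= big_split addrK.
apply: is_cvgB; apply: ge0_cvg => // [i|].
  by rewrite -lerBlDr sub0r lerNl -normrN ler_norm.
by apply: usummableD => //; exists M.
Qed.

Lemma usum_cvg a : usummable a ->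
  fset_sum a @ fsets_eventually --> usum a.
Proof. exact: usum_is_cvg. Qed.

Lemma usum_unique a l :
  fset_sum a @ fsets_eventually --> l -> usum a = l.
Proof. exact: cvg_lim. Qed.

Lemma usumD a b : usummable a -> usummable b ->
  usum (fun i => a i + b i) = usum a + usum b.
Proof.
move=> sa sb; apply: usum_unique.
have -> : fset_sum (fun i => a i + b i) = fset_sum a \+ fset_sum b.
  by apply/funext => A; rewrite /fset_sum /= big_split.
by apply: cvgD; apply: usum_cvg.
Qed.

Lemma usumZ c a : usummable a -> usum (fun i => c * a i) = c * usum a.
Proof.
move=> sa; apply: usum_unique.
have -> : fset_sum (fun i => c * a i) = (fun A => c * fset_sum a A).
  by apply/funext => A; rewrite /fset_sum mulr_sumr.
by apply: cvgMr; apply: usum_cvg.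
Qed.

Lemma le_usum a A : (forall i, 0 <= a i) -> usummable a ->
  \sum_(i <- A) a i <= usum a.
Proof.
move=> a0 /usum_cvg sa; apply: (cvgr_to_ge sa).
by exists A => // B /=; apply: ler_sum_fsubset.
Qed.

Lemma usum_le a M : usummable a -> (forall A, \sum_(i <- A) a i <= M) ->
  usum a <= M.
Proof. by move=> /usum_cvg sa aM; apply: (cvgr_to_le sa); apply: nearW. Qed.

Lemma finite_usummable a A : (forall i, i \notin A -> a i = 0) -> usummable a.
Proof.
move=> aA; exists (\sum_(i <- A) `|a i|) => B.
rewrite (@big_fset_incl _ _ _ _ A (A `|` B)%fset) ?fsubsetUl//.
  by apply: ler_sum_fsubset; rewrite ?fsubsetUr.
by move=> i _ /aA ->; rewrite normr0.
Qed.

Lemma finite_usum a A : (forall i, i \notin A -> a i = 0) ->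
  usum a = \sum_(i <- A) a i.
Proof.
move=> aA; apply: usum_unique; apply: cvg_near_cst.
exists A => // B /= AB; apply/esym.
by apply: big_fset_incl => // i _; apply: aA.
Qed.

End UnorderedSum.

Section UnorderedSumReindex.
Variables (R : realType) (I : choiceType) (e e' : I -> I).
Hypotheses (eK : cancel e e') (eK' : cancel e' e).

Lemma sum_reindex_fset (a : I -> R) (A : {fset I}) :
  \sum_(i <- A) a (e i) = \sum_(i <- [fset e i | i in A]%fset) a i.
Proof. by rewrite big_imfset //= => i j _ _; apply: (can_inj eK). Qed.

Lemma usummable_reindex (a : I -> R) : usummable a -> usummable (a \o e).
Proof.
move=> [M aM]; exists M => A.
by rewrite (sum_reindex_fset (fun i => `|a i|)).
Qed.

(** A bijection preserves finiteness and inclusion, so the net of finite subsets is only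
    relabelled. *)
Lemma usum_reindex (a : I -> R) : usummable a -> usum (a \o e) = usum a.
Proof.
move=> /usum_cvg sa; apply: usum_unique.
have -> : fset_sum (a \o e) =
    fun A : {fset I} => fset_sum a [fset e i | i in A]%fset.
  by apply/funext => A; apply: sum_reindex_fset.
apply: cvg_trans sa => P [A _ AP].
exists [fset e' i | i in A]%fset => // B /= eAB; apply: AP => /=.
apply/fsubsetP => i iA; apply/imfsetP; exists (e' i); rewrite ?eK'//=.
by apply: (fsubsetP eAB); apply: in_imfset.
Qed.
End UnorderedSumReindex.

(** * Square norm of a dot product *)

Section MakeDot.
Variables (R : realType) (V : lmodType R[i]) (op : V -> V -> R[i]).
Hypotheses (op_linear : forall z, linear_for *%R (op^~ z))
  (op_conj : forall x y, op x y = Num.conj (op y x))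
  (op_gt0 : forall x, x != 0 -> 0 < op x x).

Let op_linearr z : linear_for (Num.conj \; *%R) (op z).
Proof.
by move=> a x y; rewrite op_conj op_linear rmorphD rmorphM /= -!op_conj.
Qed.

Let op_hermitian x y : op x y = (-1) ^+ false * Num.conj (op y x).
Proof. by rewrite expr0 mul1r. Qed.

(** Conjugate symmetry transports linearity to the second variable, so each inner product below is
    obtained from three conditions. *)
Definition make_dot : {dot V for Num.conj} :=
  HB.pack op
    (@bilinear_isBilinear.Build _ _ _ _ _ _ op (op_linear, op_linearr))
    (@isHermitianSesquilinear.Build _ _ _ _ op op_hermitian)
    (@isDotProduct.Build _ _ op op_gt0).

Lemma make_dotE x y : make_dot x y = op x y. Proof. by []. Qed.

End MakeDot.

Section SquareNorm.
Variables (R : realType) (V : lmodType R[i]) (dot : {dot V for Num.conj}).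
Implicit Types (x y z : V).

Definition sqnorm x : R := complex.Re (dot x x).

Lemma dotC x y : dot x y = Num.conj (dot y x).
Proof. by rewrite [LHS](@hermitian_subproof _ _ _ _ dot) expr0 mul1r. Qed.

Lemma sqnormE x : ((sqnorm x)%:C)%C = dot x x.
Proof. by apply: RRe_real; apply: ger0_real; apply: dnorm_ge0. Qed.

Lemma sqnorm_ge0 x : 0 <= sqnorm x.
Proof. by rewrite -ler0c sqnormE dnorm_ge0. Qed.

Lemma sqnorm0 : sqnorm 0 = 0.
Proof. by rewrite /sqnorm linear0l. Qed.

Lemma sqnorm_eq0 x : sqnorm x = 0 -> x = 0.
Proof. by move=> x0; apply/eqP; rewrite -(dnorm_eq0 dot) -sqnormE x0. Qed.

Lemma sqnormZ (a : R[i]) x :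
  sqnorm (a *: x) = (complex.Re a ^+ 2 + complex.Im a ^+ 2) * sqnorm x.
Proof.
by apply: complexI; rewrite sqnormE dnormZ -add_Re2_Im2 rmorphM /= sqnormE.
Qed.

Lemma sqnormN x : sqnorm (- x) = sqnorm x.
Proof. by rewrite -scaleN1r sqnormZ /= oppr0 expr0n addr0 sqrrN expr1n mul1r. Qed.

Lemma sqnormB x y : sqnorm (x - y) = sqnorm (y - x).
Proof. by rewrite -sqnormN opprB. Qed.

Lemma sqnormD x y :
  sqnorm (x + y) = sqnorm x + sqnorm y + 2 * complex.Re (dot x y).
Proof.
rewrite /sqnorm dnormD; case: (dot x x) => a b; case: (dot y y) => c d.
by case: (dot x y) => e f /=; rewrite mulr_natl.
Qed.

(** This is [0 <= sqnorm (x - y)] after expansion. It stands in for the triangle inequality in the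
    square-summable estimates. *)
Lemma le_sqnormD x y : sqnorm (x + y) <= 2 * (sqnorm x + sqnorm y).
Proof.
have := sqnorm_ge0 (x - y).
rewrite !sqnormD sqnormN linearNr /= => h; lra.
Qed.

(** Expand the squared norms of [x + y] and [x - y]. The additive form of the bound lets summability
    of inner products follow by comparison. *)
Lemma Re_dot_le x y : `|complex.Re (dot x y)| <= sqnorm x + sqnorm y.
Proof.
have := sqnorm_ge0 (x - y); have := sqnorm_ge0 (x + y).
have := sqnorm_ge0 x; have := sqnorm_ge0 y.
rewrite !sqnormD sqnormN linearNr raddfN ler_norml /= => h1 h2 h3 h4.
by apply/andP; split; lra.
Qed.

Lemma Im_dot_le x y : `|complex.Im (dot x y)| <= sqnorm x + sqnorm y.
Proof.
have := Re_dot_le ('i%C *: x) y.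
by rewrite linearZl_LR /= sqnormZ /= expr0n expr1n add0r mul1r mulrC ReiNIm normrN.
Qed.

Lemma Re_dot_CS x y : complex.Re (dot x y) ^+ 2 <= sqnorm x * sqnorm y.
Proof.
set c := complex.Re (dot x y).
have h (s t : R) : 0 <= s ^+ 2 * sqnorm x + t ^+ 2 * sqnorm y + 2 * (s * t * c).
  have := sqnorm_ge0 (s%:C%C *: x + t%:C%C *: y).
  have -> : sqnorm (s%:C%C *: x + t%:C%C *: y) =
    s ^+ 2 * sqnorm x + t ^+ 2 * sqnorm y +
    2 * complex.Re (dot (s%:C%C *: x) (t%:C%C *: y)).
    by rewrite sqnormD !sqnormZ /= !expr0n !addr0.
  have -> : dot (s%:C%C *: x) (t%:C%C *: y) = (s * t)%:C%C * dot x y.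
    rewrite [LHS]linearZl_LR /= [dot x _]linearZr_LR /=.
    by rewrite rmorphM -mulrA; congr (_ * (_ * _)); apply: conjc_real.
  rewrite /c; case: (dot x y) => u v /=.
  by rewrite mul0r subr0.
have [y0|y0] := eqVneq (sqnorm y) 0; last first.
  (* At [s = sqnorm y] and [t = - c] the quadratic form equals [sqnorm y] times the difference to be
     shown nonnegative. *)
  have := h (sqnorm y) (- c); have y_gt0 : 0 < sqnorm y.
    by rewrite lt_def y0 sqnorm_ge0.
  rewrite (_ : _ + _ = sqnorm y * (sqnorm x * sqnorm y - c ^+ 2)); last by ring.
  by rewrite pmulr_rge0// subr_ge0.
by rewrite /c (sqnorm_eq0 y0) linear0r sqnorm0 mulr0 /= expr0n.
Qed.

Lemma sqrt_sqnormD x y :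
  Num.sqrt (sqnorm (x + y)) <= Num.sqrt (sqnorm x) + Num.sqrt (sqnorm y).
Proof.
rewrite -(@ler_pXn2r _ 2)// ?nnegrE ?addr_ge0 ?sqrtr_ge0//.
rewrite sqrrD addrAC !sqr_sqrtr ?sqnorm_ge0// sqnormD.
rewrite lerD2l -[leRHS]mulr_natl ler_pM2l// -sqrtrM ?sqnorm_ge0//.
apply: le_trans (ler_norm _) _.
rewrite -sqrtr_sqr ler_sqrt ?Re_dot_CS//.
by rewrite mulr_ge0 ?sqnorm_ge0.
Qed.

End SquareNorm.

Definition dot_complete (R : realType) (V : lmodType R[i])
    (dot : {dot V for Num.conj}) : Prop :=
  forall u : nat -> V,
  (forall e : R, 0 < e -> exists N, forall m n,
     (N <= m)%N -> (N <= n)%N -> sqnorm dot (u m - u n) <= e) ->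
  exists l, forall e : R, 0 < e -> exists N, forall n,
     (N <= n)%N -> sqnorm dot (u n - l) <= e.

(** * Abstract Hilbert spaces: complex numbers and products *)

Lemma complete_seq (K : numFieldType) (V : completeNormedModType K)
    (u : nat -> V) :
  (forall e : K, 0 < e -> exists N, forall m n,
     (N <= m)%N -> (N <= n)%N -> `|u m - u n| <= e) ->
  exists l, forall e : K, 0 < e -> exists N, forall n,
     (N <= n)%N -> `|u n - l| <= e.
Proof.
move=> u_cauchy; have : cvg (u @ \oo).
  apply: cauchy_cvg; apply: cauchy_exP => e e0.
  have [N uN] := u_cauchy (e / 2) (divr_gt0 e0 (ltr0Sn _ _)).
  exists (u N); exists N => // n /= Nn; rewrite -ball_normE /=.
  by rewrite (le_lt_trans (uN _ _ _ _))// gtr_pMr// invf_lt1 ?ltr1n.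
move=> /cvg_ex[l /cvgrPdist_le ul]; exists l => e e0.
have [N _ uN] := ul e e0; exists N => n Nn.
by rewrite distrC; apply: uN.
Qed.

(* Hilbert spaces with completeness stated on sequences and no topology, so that
   products and direct sums need not carry one. *)
Record hspace (R : realType) := HSpace {
  hcarrier :> lmodType R[i];
  hdot : {dot hcarrier for Num.conj};
  hdot_complete : dot_complete hdot }.

Section OfHilbert.
Variables (R : realType) (E : hilbertSpace R).

Lemma hnormE (v : E) : ((hnorm v)%:C)%C = `|v|.
Proof. by apply: RRe_real; apply: ger0_real; apply: normr_ge0. Qed.

Lemma hnorm_ge0 (v : E) : 0 <= hnorm v.
Proof. by rewrite -ler0c hnormE normr_ge0. Qed.

Lemma sqr_hnorm (v : E) : hnorm v ^+ 2 = sqnorm (dotp E) v.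
Proof. by apply: complexI; rewrite sqnormE -dotp_norm rmorphXn /= hnormE. Qed.

Lemma dotp_complete : dot_complete (dotp E).
Proof.
move=> u u_cauchy; have [|l ul] := @complete_seq _ E u.
  move=> e e0; have e0' : 0 < complex.Re e.
    by move: e0; rewrite ltcE => /andP[].
  have -> : e = ((complex.Re e)%:C)%C by rewrite RRe_real// gtr0_real.
  have [N uN] := u_cauchy _ (exprn_gt0 2 e0'); exists N => m n Nm Nn.
  rewrite -hnormE lecR -(@ler_pXn2r _ 2)// ?nnegrE ?hnorm_ge0 ?(ltW e0')//.
  by rewrite sqr_hnorm uN.
exists l => e e0; have [|N uN] := ul ((Num.sqrt e)%:C)%C.
  by rewrite ltcR sqrtr_gt0.
exists N => n /uN; rewrite -hnormE lecR -sqr_hnorm.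
rewrite -(@ler_pXn2r _ 2)// ?nnegrE ?hnorm_ge0 ?sqrtr_ge0//.
by rewrite sqr_sqrtr ?(ltW e0).
Qed.

Definition of_hilbert : hspace R := HSpace dotp_complete.

End OfHilbert.

Section ComplexHilbert.
Variable R : realType.

Let mulC_op (x y : R[i]^o) : R[i] := x * Num.conj y.

Let op_linear z : linear_for *%R (mulC_op^~ z).
Proof. by move=> a x y; rewrite /mulC_op mulrDl -mulrA. Qed.

Let op_conj x y : mulC_op x y = Num.conj (mulC_op y x).
Proof. by rewrite /mulC_op rmorphM /= mulrC; congr (_ * _); rewrite conjCK. Qed.

Let op_gt0 x : x != 0 -> 0 < mulC_op x x.
Proof. by move=> x0; rewrite /mulC_op -normCK exprn_gt0// normr_gt0. Qed.

Definition complex_dot := make_dot op_linear op_conj op_gt0.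

Lemma sqnorm_complex (x : R[i]^o) :
  sqnorm complex_dot x = complex.Re x ^+ 2 + complex.Im x ^+ 2.
Proof.
by apply: complexI; rewrite sqnormE make_dotE /mulC_op -normCK add_Re2_Im2.
Qed.

Lemma complex_dot_complete : dot_complete complex_dot.
Proof.
move=> u u_cauchy.
(* Real and imaginary parts are treated at once: [f] is additive and dominated by the modulus, hence
   sends Cauchy sequences to Cauchy sequences of reals. *)
have part (f : R[i] -> R) : (forall x y, f (x - y) = f x - f y) ->
    (forall z, f z ^+ 2 <= complex.Re z ^+ 2 + complex.Im z ^+ 2) ->
    exists l, forall e : R, 0 < e -> exists N, forall n,
     (N <= n)%N -> `|f (u n) - l| <= e.
  move=> fB fle; apply: (@complete_seq _ R)  => e e0.
  have [N uN] := u_cauchy _ (exprn_gt0 2 e0); exists N => m n Nm Nn.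
  rewrite -(@ler_pXn2r _ 2)// ?nnegrE ?(ltW e0)// -fB real_normK ?num_real//.
  by apply: le_trans (fle _) _; rewrite -sqnorm_complex uN.
have [l1 ul1] : exists l, forall e : R, 0 < e -> exists N, forall n,
    (N <= n)%N -> `|complex.Re (u n) - l| <= e.
  by apply: part => [[a b] [c d]//|z]; rewrite lerDl sqr_ge0.
have [l2 ul2] : exists l, forall e : R, 0 < e -> exists N, forall n,
    (N <= n)%N -> `|complex.Im (u n) - l| <= e.
  by apply: part => [[a b] [c d]//|z]; rewrite lerDr sqr_ge0.
exists (Complex l1 l2) => e e0.
have e2 : 0 < Num.sqrt (e / 2) by rewrite sqrtr_gt0 divr_gt0.
have [[N1 uN1] [N2 uN2]] := (ul1 _ e2, ul2 _ e2).
exists (maxn N1 N2) => n; rewrite geq_max => /andP[/uN1 h1 /uN2 h2].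
rewrite sqnorm_complex [leRHS]splitr.
have sq (x : R) : `|x| <= Num.sqrt (e / 2) -> x ^+ 2 <= e / 2.
  rewrite -(@ler_pXn2r _ 2)// ?nnegrE ?sqrtr_ge0// sqr_sqrtr ?divr_ge0 ?(ltW e0)//.
  by rewrite real_normK ?num_real.
by case: (u n) h1 h2 => a b /= h1 h2; apply: lerD; apply: sq.
Qed.

Definition complex_hspace : hspace R := HSpace complex_dot_complete.

End ComplexHilbert.

Section ProdHilbert.
Variables (R : realType) (V W : hspace R).

Let prod_op (x y : V * W) : R[i] :=
  hdot V x.1 y.1 + hdot W x.2 y.2.

Let op_linear z : linear_for *%R (prod_op^~ z).
Proof.
move=> a x y; rewrite /prod_op /= !linearPl /= mulrDr addrACA; congr (_ + _).
Qed.

Let op_conj x y : prod_op x y = Num.conj (prod_op y x).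
Proof. by rewrite /prod_op rmorphD /= -!dotC. Qed.

Let op_gt0 x : x != 0 -> 0 < prod_op x x.
Proof.
case: x => x y xy0; rewrite /prod_op /= lt_def addr_ge0 ?dnorm_ge0// andbT.
apply: contra xy0; rewrite paddr_eq0 ?dnorm_ge0// !dnorm_eq0.
by move=> /andP[/eqP-> /eqP->].
Qed.

Definition prod_dot := make_dot op_linear op_conj op_gt0.

Lemma sqnorm_prod (x : V * W) :
  sqnorm prod_dot x = sqnorm (hdot V) x.1 + sqnorm (hdot W) x.2.
Proof. by apply: complexI; rewrite sqnormE make_dotE rmorphD /= !sqnormE. Qed.

Lemma prod_dot_complete : dot_complete prod_dot.
Proof.
move=> u u_cauchy.
have [l1 ul1] : exists l, forall e : R, 0 < e -> exists N, forall n,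
    (N <= n)%N -> sqnorm (hdot V) ((u n).1 - l) <= e.
  apply: (@hdot_complete _ V (fun n => (u n).1)) => e /u_cauchy[N uN].
  exists N => m n Nm Nn.
  apply: le_trans (uN _ _ Nm Nn).
  by rewrite sqnorm_prod lerDl sqnorm_ge0.
have [l2 ul2] : exists l, forall e : R, 0 < e -> exists N, forall n,
    (N <= n)%N -> sqnorm (hdot W) ((u n).2 - l) <= e.
  apply: (@hdot_complete _ W (fun n => (u n).2)) => e /u_cauchy[N uN].
  exists N => m n Nm Nn.
  apply: le_trans (uN _ _ Nm Nn).
  by rewrite sqnorm_prod lerDr sqnorm_ge0.
exists (l1, l2) => e e0.
have e2 : 0 < e / 2 by rewrite divr_gt0.
have [[N1 uN1] [N2 uN2]] := (ul1 _ e2, ul2 _ e2).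
exists (maxn N1 N2) => n; rewrite geq_max => /andP[/uN1 h1 /uN2 h2].
by rewrite sqnorm_prod [leRHS]splitr lerD.
Qed.

Definition prod_hspace : hspace R := HSpace prod_dot_complete.

End ProdHilbert.

(** * Square-summable families *)

Section Ell2Type.
Variables (R : realType) (I : choiceType) (V : hspace R).

Definition ell2_pred : {pred I -> V} :=
  fun x => `[< usummable (fun i => sqnorm (hdot V) (x i)) >].

Lemma ell2_pred_closed : submod_closed ell2_pred.
Proof.
split.
  apply/asboolP; apply: (finite_usummable (A := fset0)) => i _.
  by rewrite sqnorm0.
move=> a x y /asboolP sx /asboolP sy; apply/asboolP.
pose c : R := complex.Re a ^+ 2 + complex.Im a ^+ 2.
apply: (@le_usummable _ _ _ (fun i =>
  2 * (c * sqnorm (hdot V) (x i) + sqnorm (hdot V) (y i)))).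
  move=> i; rewrite ger0_norm ?sqnorm_ge0// -sqnormZ.
  exact: le_sqnormD.
by apply: usummableZ; apply: usummableD => //; apply: usummableZ.
Qed.

HB.instance Definition _ :=
  GRing.isSubmodClosed.Build R[i] (I -> V) ell2_pred ell2_pred_closed.

Record ell2 := Ell2 { ell2_fun :> I -> V; ell2P : ell2_fun \in ell2_pred }.

HB.instance Definition _ := [isSub for ell2_fun].
HB.instance Definition _ := [Choice of ell2 by <:].
HB.instance Definition _ :=
  [SubChoice_isSubLmodule of ell2 by <:].


Implicit Types x y z : ell2.

Lemma ell2_ext x y : x =1 y -> x = y.
Proof. by move=> xy; apply: val_inj; apply/funext. Qed.

Lemma ell2DE x y i : (x + y) i = x i + y i. Proof. by []. Qed.
Lemma ell2NE x i : (- x) i = - x i. Proof. by []. Qed.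
Lemma ell2ZE a x i : (a *: x) i = a *: x i. Proof. by []. Qed.

Lemma usummable_sqnorm x : usummable (fun i => sqnorm (hdot V) (x i)).
Proof. by apply/asboolP; apply: ell2P. Qed.

Lemma usummable_Re x y :
  usummable (fun i => complex.Re (hdot V (x i) (y i))).
Proof.
apply: le_usummable (usummableD (usummable_sqnorm x) (usummable_sqnorm y)).
by move=> i; apply: Re_dot_le.
Qed.

Lemma usummable_Im x y :
  usummable (fun i => complex.Im (hdot V (x i) (y i))).
Proof.
apply: le_usummable (usummableD (usummable_sqnorm x) (usummable_sqnorm y)).
by move=> i; apply: Im_dot_le.
Qed.

(** [usum] is real valued, so the series of inner products is summed by real and imaginary parts,
    both absolutely summable. *)
Let op x y : R[i] :=
  Complex (usum (fun i => complex.Re (hdot V (x i) (y i))))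
    (usum (fun i => complex.Im (hdot V (x i) (y i)))).

Let op_linear z : linear_for *%R (op^~ z).
Proof.
move=> a x y; rewrite /op.
have lin i : hdot V ((a *: x + y) i) (z i) =
    a * hdot V (x i) (z i) + hdot V (y i) (z i).
  by rewrite ell2DE ell2ZE linearPl.
have [sRx sIx] := (usummable_Re x z, usummable_Im x z).
have [sRy sIy] := (usummable_Re y z, usummable_Im y z).
have eRe : (fun i => complex.Re (hdot V ((a *: x + y) i) (z i))) =
    (fun i => (complex.Re a * complex.Re (hdot V (x i) (z i)) +
      - complex.Im a * complex.Im (hdot V (x i) (z i))) +
      complex.Re (hdot V (y i) (z i))).
  apply/funext => i; rewrite lin; case: a (hdot V _ _) (hdot V _ _) {lin}.
  by move=> a b [c d] [e f] /=; rewrite mulNr.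
have eIm : (fun i => complex.Im (hdot V ((a *: x + y) i) (z i))) =
    (fun i => (complex.Re a * complex.Im (hdot V (x i) (z i)) +
      complex.Im a * complex.Re (hdot V (x i) (z i))) +
      complex.Im (hdot V (y i) (z i))).
  apply/funext => i; rewrite lin; case: a (hdot V _ _) (hdot V _ _) {lin eRe}.
  by move=> a b [c d] [e f] /=.
rewrite eRe eIm !usumD ?usumZ//; try apply: usummableZ => //; last 2 first.
- by apply: usummableD; apply: usummableZ.
- by apply: usummableD; apply: usummableZ.
by case: (a) => b c /=; apply/eqP; rewrite eq_complex /= mulNr !eqxx.
Qed.

Let op_conj x y : op x y = Num.conj (op y x).
Proof.
rewrite /op; apply/eqP; rewrite eq_complex /=; apply/andP; split; apply/eqP.
  by congr usum; apply/funext => i; rewrite dotC; case: (hdot V _ _).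
rewrite -mulN1r -usumZ; last exact: usummable_Im.
by congr usum; apply/funext => i; rewrite dotC mulN1r; case: (hdot V _ _).
Qed.

Let opxx x : op x x = ((usum (fun i => sqnorm (hdot V) (x i)))%:C)%C.
Proof.
apply/eqP; rewrite eq_complex /=; apply/andP; split; apply/eqP => //.
(* Each [hdot V (x i) (x i)] is real, so the family of imaginary parts is supported on the empty
   set. *)
rewrite (@finite_usum _ _ _ fset0) ?big_seq_fset0// => i _.
by rewrite -sqnormE.
Qed.

Let op_gt0 x : x != 0 -> 0 < op x x.
Proof.
move=> x0; rewrite opxx ltcR.
have [i xi0] : exists i, x i != 0.
  apply: contrapT => nex; move/eqP: x0; apply; apply: ell2_ext => i.
  by apply/eqP; apply: contrapT => /negP xi; apply: nex; exists i.
have xi_gt0 : 0 < sqnorm (hdot V) (x i).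
  rewrite lt_def sqnorm_ge0 andbT; apply: contra xi0 => /eqP h.
  by rewrite (sqnorm_eq0 h).
apply: lt_le_trans xi_gt0 _.
have := @le_usum _ _ _ [fset i]%fset (fun i => sqnorm_ge0 (hdot V) (x i))
  (usummable_sqnorm x).
by rewrite big_seq_fset1.
Qed.

Definition ell2_dot := make_dot op_linear op_conj op_gt0.

Lemma sqnorm_ell2 x :
  sqnorm ell2_dot x = usum (fun i => sqnorm (hdot V) (x i)).
Proof. by []. Qed.

Lemma le_sqnorm_ell2 x (A : {fset I}) :
  \sum_(i <- A) sqnorm (hdot V) (x i) <= sqnorm ell2_dot x.
Proof.
rewrite sqnorm_ell2; apply: le_usum => [i|]; first exact: sqnorm_ge0.
exact: usummable_sqnorm.
Qed.

Lemma sqnorm_ell2_le x M :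
  (forall A : {fset I}, \sum_(i <- A) sqnorm (hdot V) (x i) <= M) ->
  sqnorm ell2_dot x <= M.
Proof. exact/usum_le/usummable_sqnorm. Qed.

(** Coordinates converge in [V] and give a candidate [l]. The Cauchy estimate passes to [l] on each
    finite set of coordinates, with a threshold independent of that set; this yields both
    square-summability of [l] and convergence in norm. *)
Lemma ell2_dot_complete : dot_complete ell2_dot.
Proof.
move=> u u_cauchy.
have /choice[l ul] : forall i, exists li, forall e : R, 0 < e -> exists N,
    forall n, (N <= n)%N -> sqnorm (hdot V) (u n i - li) <= e.
  move=> i; apply: (@hdot_complete _ V (fun n => u n i)) => e.
  move=> /u_cauchy[N uN]; exists N => m n Nm Nn; apply: le_trans (uN _ _ Nm Nn).
  have := le_sqnorm_ell2 (u m - u n) [fset i]%fset.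
  by rewrite big_seq_fset1.
have close e : 0 < e -> exists N, forall n, (N <= n)%N ->
    forall A : {fset I}, \sum_(i <- A) sqnorm (hdot V) (u n i - l i) <= e.
  (* Passing through an auxiliary [u m] produces two terms of size at most [e / 4], and [le_sqnormD]
     contributes a factor 2. *)
  move=> e0; have e4 : 0 < e / 4 by rewrite divr_gt0.
  have [N uN] := u_cauchy _ e4; exists N => n Nn A.
  (* The index [m] may depend on [A], while [N] does not. The budget [e / 4] is shared among the
     points of [A]; the successor keeps the denominator nonzero for empty [A]. *)
  have d0 : 0 < e / 4 / #|` A|.+1%:R by rewrite divr_gt0.
  have [m Nm um] : exists2 m, (N <= m)%N & forall i, i \in A ->
      sqnorm (hdot V) (u m i - l i) <= e / 4 / #|` A|.+1%:R.
    have /choice[p pP] := fun i => ul i _ d0.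
    exists (maxn N (\max_(i <- A) p i)); first exact: leq_maxl.
    move=> i iA; apply: pP; apply: leq_trans (leq_maxr _ _).
    exact: leq_bigmax_seq.
  have split_le i : sqnorm (hdot V) (u n i - l i) <=
      2 * (sqnorm (hdot V) ((u n - u m) i) + sqnorm (hdot V) (u m i - l i)).
    apply: le_trans (le_sqnormD _ _ _).
    by rewrite ell2DE ell2NE addrA subrK.
  apply: le_trans (ler_sum _ (fun i _ => split_le i)) _.
  rewrite -mulr_sumr big_split /=.
  have h1 := le_trans (le_sqnorm_ell2 (u n - u m) A) (uN _ _ Nn Nm).
  have h2 : \sum_(i <- A) sqnorm (hdot V) (u m i - l i) <= e / 4.
    rewrite big_seq; apply: le_trans (ler_sum _ (fun i => um i)) _.
    rewrite -big_seq big_const_seq count_predT iter_addr_0.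
    rewrite -[leLHS]mulr_natr mulrAC ler_pdivrMr//.
    by apply: ler_wpM2l; [apply: ltW | rewrite ler_nat leqnSn].
  apply: le_trans (ler_wpM2l _ (lerD h1 h2)) _ => //; lra.
have lP : l \in ell2_pred.
  have [N uN] := close _ ltr01.
  apply/asboolP; exists (2 * (sqnorm ell2_dot (u N) + 1)) => A.
  have split_le i : `|sqnorm (hdot V) (l i)| <=
      2 * (sqnorm (hdot V) (u N i) + sqnorm (hdot V) (u N i - l i)).
    rewrite ger0_norm ?sqnorm_ge0// sqnormB.
    by apply: le_trans (le_sqnormD _ _ _); rewrite addrC subrK.
  apply: le_trans (ler_sum _ (fun i _ => split_le i)) _.
  rewrite -mulr_sumr ler_wpM2l// big_split lerD ?le_sqnorm_ell2//.
  exact: uN.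
exists (Ell2 lP) => e /close[N uN]; exists N => n Nn.
by apply: sqnorm_ell2_le => A; apply: uN.
Qed.

Definition ell2_hspace : hspace R := HSpace ell2_dot_complete.

End Ell2Type.

(** * Topology of an abstract Hilbert space *)

Section ToHilbert.
Variables (R : realType) (V : hspace R).

Definition hspace_normed : Type := V.

HB.instance Definition _ := GRing.Lmodule.copy hspace_normed V.

Let hs_norm (x : hspace_normed) : R[i] := ((Num.sqrt (sqnorm (hdot V) x))%:C)%C.

Let hs_normD x y : hs_norm (x + y) <= hs_norm x + hs_norm y.
Proof. by rewrite /hs_norm -rmorphD lecR; apply: sqrt_sqnormD. Qed.

Let hs_normZ (a : R[i]) x : hs_norm (a *: x) = `|a| * hs_norm x.
Proof.
rewrite /hs_norm normc_def -rmorphM sqnormZ sqrtrM //.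
by rewrite addr_ge0 ?sqr_ge0.
Qed.

Let hs_norm_eq0 x : hs_norm x = 0 -> x = 0.
Proof.
move=> /eqP; rewrite eq_complex /= eqxx andbT sqrtr_eq0 => x0.
by apply: (@sqnorm_eq0 _ _ (hdot V)); apply/eqP; rewrite eq_le x0 sqnorm_ge0.
Qed.

HB.instance Definition _ :=
  Lmodule_isNormed.Build R[i] hspace_normed hs_normD hs_normZ hs_norm_eq0.

Lemma hspace_normE (x : hspace_normed) :
  `|x| = ((Num.sqrt (sqnorm (hdot V) x))%:C)%C.
Proof. by []. Qed.

(** A Cauchy filter contains, for each [n], a ball of radius [1 / (n + 1)]. The centres form a
    Cauchy sequence, whose limit is also a limit of the filter. *)
Lemma hspace_normed_complete (F : set_system hspace_normed) :
  ProperFilter F -> cauchy F -> cvg F.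
Proof.
move=> FF /cauchyP F_cauchy.
pose r (n : nat) : R := n.+1%:R^-1.
have r_gt0 n : 0 < r n by rewrite /r invr_gt0.
have /choice[u uP] : forall n, exists x, F (ball x ((r n)%:C)%C).
  by move=> n; apply: F_cauchy; rewrite ltcR.
have dist x y (e : R) : ball (x : hspace_normed) (e%:C)%C y ->
    Num.sqrt (sqnorm (hdot V) (x - y)) <= e.
  by rewrite -ball_normE /= hspace_normE ltcR => /ltW.
have r_small (e : R) : 0 < e -> exists N, forall n, (N <= n)%N -> r n <= e.
  move=> e0; have [N _ Ne] := near_infty_natSinv_lt (PosNum e0).
  by exists N => n Nn; apply: ltW; apply: Ne.
have [l ul] : exists l, forall e : R, 0 < e -> exists N, forall n,
    (N <= n)%N -> sqnorm (hdot V) (u n - l) <= e.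
  apply: hdot_complete => e e0.
  have e2 : 0 < Num.sqrt e / 2 by rewrite divr_gt0// sqrtr_gt0.
  have [N rN] := r_small _ e2; exists N => m n Nm Nn.
  (* Two members of a proper filter meet, so the centres are at distance at most [r m + r n]. *)
  have [z [zm zn]] := filter_ex (filterI (uP m) (uP n)).
  rewrite -ler_sqrt ?(ltW e0)//.
  rewrite -[X in X - _](subrK z) -addrA; apply: le_trans (sqrt_sqnormD _ _ _) _.
  rewrite [leRHS]splitr [in X in _ + X]sqnormB.
  by apply: lerD; [apply: le_trans (rN _ Nm) | apply: le_trans (rN _ Nn)];
    apply: dist.
apply/cvg_ex; exists (l : hspace_normed); apply/cvgrPdist_le => e e0.
have e0' : 0 < complex.Re e by move: e0; rewrite ltcE => /andP[].
have -> : e = ((complex.Re e)%:C)%C by rewrite RRe_real// gtr0_real.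
have e2 : 0 < complex.Re e / 2 by rewrite divr_gt0.
have [[N1 rN] [N2 uN]] := (r_small _ e2, ul _ (exprn_gt0 2 e2)).
pose n := maxn N1 N2; apply: filterS (uP n) => x xn.
rewrite hspace_normE lecR -[X in X - _](subrK (u n)) -addrA.
apply: le_trans (sqrt_sqnormD _ _ _) _.
rewrite [leRHS]splitr sqnormB; apply: lerD.
  rewrite -[leRHS]ger0_norm ?(ltW e2)// -sqrtr_sqr ler_sqrt ?exprn_ge0 ?(ltW e2)//.
  by apply: uN; apply: leq_maxr.
by apply: le_trans (rN n _); [apply: dist | apply: leq_maxl].
Qed.

HB.instance Definition _ :=
  Uniform_isComplete.Build hspace_normed hspace_normed_complete.

(* [hdot V] cannot be reused as is: the module structure of [hspace_normed] is
   only componentwise convertible to that of [V]. *)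
Let op (x y : hspace_normed) : R[i] := hdot V x y.

Let op_linear z : linear_for *%R (op^~ z).
Proof. by move=> a x y; apply: (linearPl (hdot V)). Qed.

Let op_conj x y : op x y = Num.conj (op y x).
Proof. exact: dotC. Qed.

Let op_gt0 x : x != 0 -> 0 < op x x.
Proof. by rewrite -(dnorm_gt0 (hdot V)). Qed.

Let op_norm (v : hspace_normed) :
  `|v| ^+ 2 = make_dot op_linear op_conj op_gt0 v v.
Proof.
rewrite hspace_normE -rmorphXn /= sqr_sqrtr ?sqnorm_ge0//.
exact: (sqnormE (hdot V)).
Qed.

Definition to_hilbert : hilbertSpace R :=
  HilbertSpace op_norm.

Lemma hnorm_to_hilbert (v : to_hilbert) :
  hnorm v = Num.sqrt (sqnorm (hdot V) v).
Proof. by []. Qed.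

End ToHilbert.

(** * Word length *)

Section WordLengthTheory.
Variable G : groupType.
Implicit Types (S w : seq G) (g h : G) (m n : nat).

Lemma in_word_ball1 S : in_word_ball S 0 1%g.
Proof. by exists [::]; rewrite big_nil. Qed.

Lemma in_word_ballM S m n g h : in_word_ball S m g -> in_word_ball S n h ->
  in_word_ball S (m + n) (g * h)%g.
Proof.
move=> [v [Sv vm ->]] [w [Sw wn ->]]; exists (v ++ w); split.
- by rewrite /word all_cat -/(word _ _) Sv.
- by rewrite size_cat leq_add.
- by rewrite big_cat.
Qed.

Lemma in_word_ball_gen S g : g \in S -> in_word_ball S 1 g.
Proof. by move=> gS; exists [:: g]; rewrite /word /= gS big_seq1. Qed.

Lemma in_word_ballV S n g : in_word_ball S n g -> in_word_ball S n g^-1%g.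
Proof.
case=> w [Sw wn ->]; exists (rev [seq x^-1%g | x <- w]); split.
- rewrite /word all_rev all_map; apply: sub_all Sw => x /=.
  by rewrite invgK orbC.
- by rewrite size_rev size_map.
- elim: w {Sw wn} => [|x w IH]; first by rewrite !big_nil invg1.
  by rewrite map_cons rev_cons -cats1 big_cat big_seq1 big_cons invgM IH.
Qed.

Lemma in_word_ball_leq S m n g : (m <= n)%N ->
  in_word_ball S m g -> in_word_ball S n g.
Proof. by move=> mn [w [Sw wm ->]]; exists w; split=> //; apply: leq_trans mn. Qed.

Lemma word_length_le S n g : in_word_ball S n g -> (word_length S g <= n)%N.
Proof.
move=> Sg; rewrite /word_length; case: pselect => [ex|[]]; last by exists n.
by case: ex_minnP => m _; apply; apply/asboolP.
Qed.

Lemma word_lengthP S n g :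
  in_word_ball S n g -> in_word_ball S (word_length S g) g.
Proof.
move=> Sg; rewrite /word_length; case: pselect => [ex|[]]; last by exists n.
by case: ex_minnP => m /asboolP.
Qed.

Lemma generates_word_length S g : generates S ->
  in_word_ball S (word_length S g) g.
Proof. by move=> /(_ g)[n]; apply: word_lengthP. Qed.

Lemma word_length1 S : word_length S 1%g = 0%N.
Proof. by apply/eqP; rewrite -leqn0; apply/word_length_le/in_word_ball1. Qed.

Lemma word_lengthM S g h : generates S ->
  (word_length S (g * h)%g <= word_length S g + word_length S h)%N.
Proof.
by move=> Sgen; apply/word_length_le/in_word_ballM; apply: generates_word_length.
Qed.

Lemma word_length_gt0 S g : generates S -> g != 1%g -> (0 < word_length S g)%N.
Proof.
move=> Sgen; apply: contraNT; rewrite -leqNgt leqn0 => /eqP g0.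
have [w [_]] := generates_word_length g Sgen.
by rewrite g0 leqn0 => /nilP-> ->; rewrite big_nil.
Qed.

(** Each letter of [S] is rewritten as an [S']-word of length at most [M]. This links the generating
    set that defines the compression of [G] with the one used in the wreath product. *)
Lemma word_length_lipschitz S S' : generates S -> generates S' ->
  exists M, forall g, (word_length S' g <= M * word_length S g)%N.
Proof.
move=> Sgen S'gen; pose M := \max_(x <- S) word_length S' x.
exists M => g; have [w [Sw wn {1}->]] := generates_word_length g Sgen.
rewrite word_length_le//; apply: (@in_word_ball_leq _ (M * size w)).
  by rewrite leq_mul2l wn orbT.
elim: w Sw {wn} => [_|x w IH /= /andP[xS Sw]].
  by rewrite big_nil muln0; apply: in_word_ball1.
rewrite big_cons mulnS; apply: in_word_ballM; last exact: IH.
have MS y : y \in S -> in_word_ball S' M y.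
  move=> yS; apply: in_word_ball_leq (generates_word_length y S'gen).
  exact: leq_bigmax_seq.
case/orP: xS => /MS //; rewrite -[X in _ -> in_word_ball _ _ X]invgK.
exact: in_word_ballV.
Qed.

End WordLengthTheory.

(** * Word length in the wreath product *)

(** Words are mapped letter by letter. It serves for the inclusions of [G], at the identity of [H],
    and of [H] in the wreath product. *)
Lemma in_word_ball_morph (G G' : groupType) (f : G -> G') (S : seq G)
    (S' : seq G') n g :
  (forall x y, f (x * y)%g = (f x * f y)%g) ->
  (forall x, x \in S -> f x \in S') ->
  in_word_ball S n g -> in_word_ball S' n (f g).
Proof.
move=> fM fS [w [Sw wn ->]].
have f1 : f 1%g = 1%g by apply: (mulgI (f 1%g)); rewrite -fM !mulg1.
have fV x : f x^-1%g = (f x)^-1%g.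
  by apply: (mulgI (f x)); rewrite -fM !mulgV.
exists (map f w); split; rewrite ?size_map//.
- rewrite /word all_map; apply: sub_all Sw => x /= /orP[/fS ->//|/fS].
  by rewrite fV => ->; rewrite orbT.
- by rewrite big_map (big_morph f fM f1).
Qed.

Section WreathWords.
Variables (G H : groupType) (SG : seq G) (SH : seq H).
Hypotheses (SG_gen : generates SG) (SH_gen : generates SH).
Implicit Types (f : dsum H G) (g : G) (h x : H).

Local Notation lenG := (word_length SG).
Local Notation lenH := (word_length SH).
Local Notation gens := (wreath_gens SG SH).

Lemma dsum_deltaE g x : dsum_delta H g x = if x == 1%g then g else 1%g.
Proof. by rewrite /dsum_delta /dsum_app fsfun_withE /= fsfunE. Qed.

Let dsumE := (dsum_translateE, dsum_mulE, dsum_oneE, dsum_invE, dsum_deltaE).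

Lemma in_word_ball_delta n g : in_word_ball SG n g ->
  in_word_ball gens n (Wreath (dsum_delta H g) 1%g).
Proof.
apply: (in_word_ball_morph (f := fun g => Wreath (dsum_delta H g) 1%g))
  => [x y|x xS].
  apply: wr_ext => [z|] /=; last by rewrite mulg1.
  by rewrite !dsumE invg1 mul1g; case: ifP; rewrite ?mulg1.
by rewrite mem_cat map_f.
Qed.

Lemma in_word_ball_pos n h : in_word_ball SH n h ->
  in_word_ball gens n (Wreath 1%g h).
Proof.
apply: (in_word_ball_morph (f := fun h => Wreath 1%g h)) => [x y|x xS].
  by apply: wr_ext => [z|] //=; rewrite !dsumE mulg1.
by rewrite mem_cat map_f ?orbT.
Qed.

(** Walk to [h], write [g] there, walk back: conjugation by the position costs twice [lenH h]. *)
Lemma in_word_ball_translate g h :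
  in_word_ball gens (lenG g + 2 * lenH h)
    (Wreath (dsum_translate h (dsum_delta H g)) 1%g).
Proof.
have -> : Wreath (dsum_translate h (dsum_delta H g)) 1%g =
    (Wreath 1 h * Wreath (dsum_delta H g) 1 * (Wreath 1 h)^-1)%g :> wreath G H.
  apply: wr_ext => [x|] /=; last by rewrite mulg1 mulgV.
  by rewrite !dsumE mul1g invg1 mulg1.
have hball := in_word_ball_pos (generates_word_length h SH_gen).
rewrite mul2n -addnn addnCA addnA; apply: in_word_ballM; last exact: in_word_ballV.
apply: in_word_ballM hball _.
exact/in_word_ball_delta/generates_word_length.
Qed.

(** The points of [s] are treated one at a time, each by a separate excursion from the identity; no
    short tour of the support is sought. *)
Lemma in_word_ball_dsum f (s : seq H) : (forall x, x \notin s -> f x = 1%g) ->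
  in_word_ball gens (\sum_(h <- s) (lenG (f h) + 2 * lenH h)) (Wreath f 1%g).
Proof.
elim: s f => [|h s IH] f fs.
  rewrite big_nil (_ : Wreath f 1%g = 1%g); first exact: in_word_ball1.
  by apply: wr_ext => //= x; rewrite fs// dsum_oneE.
(* [t] carries the value of [f] at [h] alone, and [f'] is [f] with that value erased. *)
pose t := dsum_translate h (dsum_delta H (f h)); pose f' : dsum H G := (t^-1 * f)%g.
have f'E x : f' x = if x == h then 1%g else f x.
  rewrite /f' /t !dsumE.
  have [->|xh] := eqVneq x h; first by rewrite mulVg eqxx mulVg.
  rewrite ifF ?invg1 ?mul1g//; apply/negP => /eqP hx1; case/eqP: xh.
  by rewrite -[x](mulVKg h) hx1 mulg1.
have -> : Wreath f 1%g = (Wreath t 1 * Wreath f' 1)%g :> wreath G H.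
  by apply: wr_ext => [x|] /=; rewrite ?mulg1// /f' !dsumE invg1 mul1g mulVKg.
rewrite big_cons; apply: in_word_ballM; first exact: in_word_ball_translate.
(* Should [h] recur in [s], the erased value has length 0 there, so passing from [f] to [f'] can
   only lower the sum. *)
apply: (@in_word_ball_leq _ _ (\sum_(x <- s) (lenG (f' x) + 2 * lenH x))).
  apply: leq_sum => x _; rewrite leq_add2r f'E.
  by case: ifP => // _; rewrite word_length1.
apply: IH => x xs; rewrite f'E; have [//|xh] := eqVneq x h.
by apply: fs; rewrite inE negb_or xh.
Qed.

Lemma wreath_sublength_le f (A : {fset H}) : (forall x, x \notin A -> f x = 1%g) ->
  (wreath_sublength SG SH f <= \sum_(h <- A) (lenG (f h) + 2 * lenH h))%N.
Proof. by move=> fA; apply/word_length_le/in_word_ball_dsum. Qed.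

(** Recording length at most 1 instead of membership treats generators and their inverses alike. *)
Lemma wreath_gen_cases (u : wreath G H) : (u \in gens) || (u^-1%g \in gens) ->
  (exists2 g, (lenG g <= 1)%N & u = Wreath (dsum_delta H g) 1%g) \/
  (exists2 h, (lenH h <= 1)%N & u = Wreath 1%g h).
Proof.
rewrite /wreath_gens; case/orP; rewrite mem_cat => /orP[] /mapP[y yS uE].
- by left; exists y => //; apply/word_length_le/in_word_ball_gen.
- by right; exists y => //; apply/word_length_le/in_word_ball_gen.
- left; exists y^-1%g; first exact/word_length_le/in_word_ballV/in_word_ball_gen.
  rewrite -[u]invgK uE; apply: wr_ext => [x|] /=; rewrite ?invg1//.
  rewrite !dsumE !invg1 mul1g.
  by case: ifP; rewrite ?invg1.
- right; exists y^-1%g; first exact/word_length_le/in_word_ballV/in_word_ball_gen.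
  by rewrite -[u]invgK uE; apply: wr_ext => [x|] //=; rewrite !dsumE invg1.
Qed.

(** Induction on the last letter: one from [G] alters the function only at the current position, one
    from [H] only moves the position, by at most one step. So the support lies among visited
    positions, and the total length of the values grows by at most 1 per letter. *)
Lemma wreath_ball_bounds n (u : wreath G H) : in_word_ball gens n u ->
  [/\ (lenH (wr_pos u) <= n)%N,
      forall h, wr_fun u h != 1%g -> (lenH h <= n)%N
    & forall A : {fset H}, (\sum_(h <- A) lenG (wr_fun u h) <= n)%N].
Proof.
move=> [w [Sw wn ->]]; move: wn.
elim/last_ind: w n Sw => [|w y IH] n.
  move=> _ _; rewrite big_nil /= word_length1; split => // [h|A].
    by rewrite dsum_oneE eqxx.
  by rewrite big1// => h _; rewrite dsum_oneE word_length1.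
rewrite /word all_rcons size_rcons => /andP[/wreath_gen_cases ygen Sw].
case: n => // n wn; have [pn fn An] := IH n Sw wn.
rewrite -cats1 big_cat big_seq1; set v := (\prod_(x <- w) x)%g in pn fn An *.
case: ygen => [[g g1 ->]|[k k1 ->]] /=; last first.
  have E h : dsum_app (wr_fun v * dsum_translate (wr_pos v) 1)%g h = wr_fun v h.
    by rewrite !dsumE mulg1.
  split=> [|h|A].
  - by apply: leq_trans (word_lengthM _ _ SH_gen) _; rewrite -addn1 leq_add.
  - by rewrite E => /fn /leqW.
  - by under eq_bigr do rewrite E; apply: leqW.
have E h : dsum_app (wr_fun v * dsum_translate (wr_pos v) (dsum_delta H g))%g h =
    if h == wr_pos v then (wr_fun v h * g)%g else wr_fun v h.
  rewrite !dsumE; have [->|hv] := eqVneq h (wr_pos v); first by rewrite mulVg eqxx.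
  rewrite ifF ?mulg1//; apply/negP => /eqP hv1; case/eqP: hv.
  by rewrite -[h](mulVKg (wr_pos v)) hv1 mulg1.
split=> [|h|A].
- by rewrite mulg1 leqW.
- by rewrite E; case: (h =P wr_pos v) => [-> _|_ /fn]; apply: leqW.
have Ele h : (lenG
    (dsum_app (wr_fun v * dsum_translate (wr_pos v) (dsum_delta H g))%g h)
    <= lenG (wr_fun v h) + (h == wr_pos v))%N.
  rewrite E; case: eqP => _; last by rewrite addn0.
  by apply: leq_trans (word_lengthM _ _ SG_gen) _; rewrite leq_add2l.
apply: leq_trans (leq_sum _ (fun h _ => Ele h)) _.
rewrite big_split /= -addn1 leq_add//.
(* The remaining sum counts the current position in [A], at most once since a finite set has no
   repetitions. *)
rewrite (eq_bigr (fun h => if h == wr_pos v then 1 else 0)%N).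
  rewrite -big_mkcond sum1_count.
  by rewrite count_uniq_mem ?fset_uniq// leq_b1.
by move=> h _; case: ifP.
Qed.

End WreathWords.

(** * The direct sum cocycle *)

Section RegularRepresentation.
Variables (R : realType) (G : groupType).
Local Notation l2G := (ell2 G (complex_hspace R)).
Local Notation dotG := (@ell2_dot R G (complex_hspace R)).
Implicit Types (g h : G) (x y : l2G).

Let mulVK g : cancel ( *%g g^-1%g) ( *%g g). Proof. exact: mulVKg. Qed.
Let mulK g : cancel ( *%g g) ( *%g g^-1%g). Proof. exact: mulKg. Qed.

Lemma ltrans_subproof g (x : l2G) :
  (fun k => x (g^-1 * k)%g) \in @ell2_pred R G (complex_hspace R).
Proof.
apply/asboolP.
exact: (usummable_reindex (mulVK g) (usummable_sqnorm x)).
Qed.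

Definition ltrans g x : l2G := Ell2 (ltrans_subproof g x).

Lemma ltrans_linear g : linear (ltrans g).
Proof. by move=> a x y; apply: ell2_ext. Qed.

Lemma ltransZ g a x : ltrans g (a *: x) = a *: ltrans g x.
Proof. exact: ell2_ext. Qed.

Lemma ltransB g x y : ltrans g (x - y) = ltrans g x - ltrans g y.
Proof. exact: ell2_ext. Qed.

Lemma ltrans1 x : ltrans 1%g x = x.
Proof. by apply: ell2_ext => k /=; rewrite invg1 mul1g. Qed.

Lemma ltransM g h x : ltrans (g * h)%g x = ltrans g (ltrans h x).
Proof. by apply: ell2_ext => k /=; rewrite invgM mulgA. Qed.

Lemma dot_ltrans g x y : dotG (ltrans g x) (ltrans g y) = dotG x y.
Proof.
apply/eqP; rewrite eq_complex /=; apply/andP; split; apply/eqP.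
  exact: (usum_reindex (mulVK g) (mulK g) (usummable_Re x y)).
exact: (usum_reindex (mulVK g) (mulK g) (usummable_Im x y)).
Qed.

Lemma point_mass_subproof g :
  (fun k => (k == g)%:R : complex_hspace R) \in @ell2_pred R G (complex_hspace R).
Proof.
apply/asboolP; apply: (finite_usummable (A := [fset g]%fset)) => k.
by rewrite inE => /negPf ->; rewrite sqnorm0.
Qed.

Definition point_mass g : l2G := Ell2 (point_mass_subproof g).

Lemma ltrans_point_mass g h : ltrans g (point_mass h) = point_mass (g * h)%g.
Proof.
apply: ell2_ext => k /=; congr (_ _); congr (_ _).
by apply/eqP/eqP => [<-|->]; rewrite ?mulVKg ?mulKg.
Qed.

Lemma sqnorm_point_massB g : g != 1%g ->
  sqnorm dotG (point_mass g - point_mass 1%g) = 2.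
Proof.
move=> g1; rewrite sqnorm_ell2 (finite_usum (A := [fset g; 1%g]%fset)); last first.
  move=> k; rewrite !inE negb_or => /andP[/negPf kg /negPf k1].
  by rewrite ell2DE ell2NE /= kg k1 subr0 sqnorm0.
rewrite big_fsetU1 ?inE// big_seq_fset1 !ell2DE !ell2NE /= !eqxx.
rewrite (negPf g1) eq_sym (negPf g1) subr0 sub0r sqnormN.
by rewrite sqnorm_complex /= expr1n expr0n addr0.
Qed.

End RegularRepresentation.

Section DirectSumOperator.
Variables (R : realType) (I : choiceType) (V : hspace R) (T : I -> V -> V).
Hypothesis T_linear : forall i, linear (T i).
Hypothesis T_dot : forall i u v, hdot V (T i u) (T i v) = hdot V u v.
Local Notation l2V := (ell2 I V).
Local Notation dotV := (@ell2_dot R I V).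
Implicit Types x y : l2V.

Lemma ell2_map_subproof x : (fun i => T i (x i)) \in @ell2_pred R I V.
Proof.
apply/asboolP; rewrite (_ : (fun i => _) = (fun i => sqnorm (hdot V) (x i))).
  exact: usummable_sqnorm.
by apply/funext => i; rewrite /sqnorm T_dot.
Qed.

Definition ell2_map x : l2V := Ell2 (ell2_map_subproof x).

Lemma ell2_map_linear : linear ell2_map.
Proof. by move=> a x y; apply: ell2_ext => i; apply: T_linear. Qed.

Lemma dot_ell2_map x y : dotV (ell2_map x) (ell2_map y) = dotV x y.
Proof.
apply/eqP; rewrite eq_complex /=; apply/andP; split; apply/eqP;
  by congr usum; apply/funext => i; rewrite /= T_dot.
Qed.

End DirectSumOperator.

(** * The weighted cocycle on the direct sum *)

Section DsumCocycle.
Variables (R : realType) (G H : groupType) (E : hilbertSpace R).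
Variables (pi : G -> {linear E -> E}) (b : G -> E).
Hypotheses (pi_unitary : unitary_representation pi) (b_cocycle : cocycle pi b).
Variable w : H -> R.

Lemma cocycle1 : b 1%g = 0.
Proof.
have := b_cocycle 1%g 1%g; case: pi_unitary => -> _ _.
by rewrite mulg1 => /eqP; rewrite -subr_eq0 opprD addNKr oppr_eq0 => /eqP.
Qed.

Local Notation l2G := (ell2_hspace G (complex_hspace R)).
Local Notation K := (prod_hspace (of_hilbert E) l2G).
Local Notation L := (ell2_hspace H K).

Definition fiber_rep (g : G) (v : K) : K := (pi g v.1, ltrans g v.2).

Lemma fiber_rep_linear g : linear (fiber_rep g).
Proof.
move=> a u v; rewrite /fiber_rep /=; congr (_, _); last exact: ltrans_linear.
exact: linearP.
Qed.

Lemma dot_fiber_rep g u v : hdot K (fiber_rep g u) (fiber_rep g v) = hdot K u v.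
Proof.
case: pi_unitary => _ _ pi_dot.
rewrite !make_dotE; congr (_ + _); [exact: pi_dot|exact: dot_ltrans].
Qed.

(* [b] may vanish on nontrivial elements; the second component does not, and so
   detects the support of an element of the direct sum. *)
Definition fiber_cocycle (h : H) (g : G) : K :=
  (b g, ((w h)%:C)%C *: (point_mass R g - point_mass R 1%g)).

(** The second component is a multiple of the coboundary of the point mass at the identity: the
    translated differences telescope. *)
Lemma fiber_cocycleM h g k :
  fiber_cocycle h (g * k)%g =
  fiber_rep g (fiber_cocycle h k) + fiber_cocycle h g.
Proof.
rewrite /fiber_cocycle /fiber_rep; congr (_, _) => /=; first exact: b_cocycle.
rewrite ltransZ ltransB !ltrans_point_mass mulg1 -scalerDr.
by congr (_ *: _); rewrite addrA subrK.
Qed.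

Lemma fiber_cocycle1 h : fiber_cocycle h 1%g = 0.
Proof. by rewrite /fiber_cocycle cocycle1 subrr scaler0. Qed.

(** The two point masses are orthonormal, whence the factor 2. At the identity the cocycle vanishes,
    so for nonzero [w h] the second term appears exactly on the support. *)
Lemma sqnorm_fiber_cocycle h g : g != 1%g ->
  sqnorm (hdot K) (fiber_cocycle h g) = hnorm (b g) ^+ 2 + 2 * w h ^+ 2.
Proof.
move=> g1; rewrite sqnorm_prod -sqr_hnorm sqnormZ /= expr0n addr0.
by rewrite sqnorm_point_massB// mulrC.
Qed.

Implicit Types f : dsum H G.

Lemma dsum_cocycle_subproof f :
  (fun h => fiber_cocycle h (f h)) \in @ell2_pred R H K.
Proof.
apply/asboolP; apply: (finite_usummable (A := finsupp f)) => h hf.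
by rewrite /dsum_app fsfun_dflt// fiber_cocycle1 sqnorm0.
Qed.

Definition dsum_cocycle f : to_hilbert L := Ell2 (dsum_cocycle_subproof f).

Definition dsum_rep f : L -> L :=
  ell2_map (fun h => @dot_fiber_rep (f h)).

Lemma hnorm_dsum_cocycle f :
  hnorm (dsum_cocycle f) ^+ 2 =
  \sum_(h <- finsupp f) (hnorm (b (f h)) ^+ 2 + 2 * w h ^+ 2).
Proof.
rewrite hnorm_to_hilbert sqr_sqrtr ?sqnorm_ge0// sqnorm_ell2.
rewrite (finite_usum (A := finsupp f)); last first.
  by move=> h hf; rewrite /= /dsum_app fsfun_dflt// fiber_cocycle1 sqnorm0.
rewrite big_seq [RHS]big_seq; apply: eq_bigr => h hf.
by rewrite sqnorm_fiber_cocycle// -mem_finsupp.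
Qed.

Lemma dsum_rep_linear f : linear (dsum_rep f : to_hilbert L -> to_hilbert L).
Proof. by apply: ell2_map_linear => h; apply: fiber_rep_linear. Qed.

Lemma dsum_cocycleP : exists (E' : hilbertSpace R)
    (pi' : dsum H G -> {linear E' -> E'}) (b' : dsum H G -> E'),
  [/\ unitary_representation pi', cocycle pi' b' &
    forall f, hnorm (b' f) ^+ 2 =
      \sum_(h <- finsupp f) (hnorm (b (f h)) ^+ 2 + 2 * w h ^+ 2)].
Proof.
pose pi' f : {linear to_hilbert L -> to_hilbert L} :=
  HB.pack (dsum_rep f : to_hilbert L -> to_hilbert L)
    (GRing.isLinear.Build _ _ _ _ _ (dsum_rep_linear f)).
case: pi_unitary => pi1 piM _.
exists (to_hilbert L), pi', dsum_cocycle; split; last exact: hnorm_dsum_cocycle.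
- split=> [v|f g v|f u v]; last exact: dot_ell2_map.
    apply: ell2_ext => h; rewrite /= dsum_oneE /fiber_rep pi1 ltrans1.
    by case: (v h).
  by apply: ell2_ext => h; rewrite /= dsum_mulE /fiber_rep piM ltransM.
- move=> f g; apply: ell2_ext => h.
  by rewrite /= dsum_mulE fiber_cocycleM.
Qed.

End DsumCocycle.

(** * Compression *)

(** For [0 < t <= 1] one has [t <= t^p]; apply this to the fractions [x / (x + y)] and
    [y / (x + y)], which add up to 1. *)
Lemma powRD_le (R : realType) (x y p : R) :
  0 <= x -> 0 <= y -> 0 < p <= 1 -> (x + y) `^ p <= x `^ p + y `^ p.
Proof.
move=> x0 y0 /andP[p0 p1].
have [s0|s_neq0] := eqVneq (x + y) 0.
  by rewrite s0 powR0 ?gt_eqF// addr_ge0 ?powR_ge0.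
have s_gt0 : 0 < x + y by rewrite lt_def s_neq0 addr_ge0.
have part z : 0 <= z -> z <= x + y -> z / (x + y) * (x + y) `^ p <= z `^ p.
  rewrite le_eqVlt => /predU1P[<- _|z0 zs]; first by rewrite !mul0r powR_ge0.
  have -> : z `^ p = (z / (x + y)) `^ p * (x + y) `^ p.
    by rewrite -powRM ?divfK// ?divr_ge0// ltW.
  rewrite ler_wpM2r ?powR_ge0// ger1_powR// divr_gt0//=.
  by rewrite ler_pdivrMr// mul1r.
apply: le_trans (lerD (part x x0 _) (part y y0 _)); rewrite ?lerDl ?lerDr//.
by rewrite -mulrDl -mulrDl divff// mul1r.
Qed.

Lemma powR_sum_le (R : realType) (I : Type) (s : seq I) (F : I -> R) (p : R) :
  (forall i, 0 <= F i) -> 0 < p <= 1 ->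
  (\sum_(i <- s) F i) `^ p <= \sum_(i <- s) F i `^ p.
Proof.
move=> F0 p01; elim: s => [|i s IH].
  by rewrite !big_nil powR0//; case/andP: p01 => /gt_eqF ->.
rewrite !big_cons; apply: le_trans (powRD_le _ _ p01) _ => //.
  exact: sumr_ge0.
by rewrite lerD2l.
Qed.

(** [x^p] is at most [x] from 1 on and at most 1 below. This absorbs the power of a position length
    into a weight linear in that length. *)
Lemma powR_le1D (R : realType) (x p : R) : 0 <= x -> 0 < p <= 1 ->
  x `^ p <= 1 + x.
Proof.
move=> x0 /andP[p0 p1]; have [x1|x1] := leP 1 x.
  by apply: le_trans (ler1_powR x1 p1) _; rewrite lerDr.
have: x `^ p <= 1 `^ p by rewrite ge0_ler_powR ?nnegrE ?(ltW p0)// ltW.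
by rewrite powR1; lra.
Qed.

Section CompressionBounds.
Variables (R : realType) (Gam : groupType) (len : Gam -> R).
Variables (E : hilbertSpace R) (b : Gam -> E).

Lemma compression_set_ub : has_ubound [set r : R | 0 <= r <= 1 /\
    exists C D : R, [/\ 0 < C, 0 < D & forall g,
      C^-1 * len g `^ r - D <= hnorm (b g) <= C * len g + D]].
Proof. by exists 1 => r [/andP[]]. Qed.

Lemma compression_le1 : compression len b <= 1.
Proof.
rewrite /compression; set A := [set r | _].
have [->|/set0P A0] := eqVneq A set0; first by rewrite sup0.
by apply: ge_sup => // r [/andP[]].
Qed.

End CompressionBounds.

(** An empty or unbounded set is covered by the default value 0 of [sup]. *)
Lemma sup_ge0 (R : realType) (A : set R) : (forall x, A x -> 0 <= x) ->
  0 <= sup A.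
Proof.
move=> A0; case: (pselect (has_sup A)) => [Asup|/sup_out -> //].
case: (Asup) => -[x Ax] Aub; apply: le_trans (A0 x Ax) _.
exact: ub_le_sup.
Qed.

(** Positivity of [x] rules out the empty set, whose [sup] is 0 by convention. *)
Lemma gt0_sup_gt (R : realType) (A : set R) (x : R) : 0 < x -> x < sup A ->
  exists2 y, A y & x < y.
Proof.
move=> x0 xA; apply: (sup_gt _ xA); apply/set0P/negP => /eqP A0.
by move: (lt_trans x0 xA); rewrite A0 sup0 ltxx.
Qed.

Lemma compression_ge0 (R : realType) (Gam : groupType) (len : Gam -> R)
    (E : hilbertSpace R) (b : Gam -> E) : 0 <= compression len b.
Proof. by apply: sup_ge0 => r [/andP[]]. Qed.

(** Two suprema are nested, over cocycles and over exponents. Both sets are bounded by 1, so a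
    single admissible exponent of a single cocycle is a lower bound. *)
Lemma equivariant_compression_ge (R : realType) (Gam : groupType)
    (len : Gam -> R) (E : hilbertSpace R) (pi : Gam -> {linear E -> E})
    (b : Gam -> E) (r C D : R) :
  unitary_representation pi -> cocycle pi b -> 0 <= r <= 1 ->
  0 < C -> 0 < D ->
  (forall g, C^-1 * len g `^ r - D <= hnorm (b g) <= C * len g + D) ->
  r <= equivariant_compression len.
Proof.
move=> pi_unitary b_cocycle r01 C0 D0 bP.
apply: (@le_trans _ _ (compression len b)).
  by apply: ub_le_sup; [apply: compression_set_ub | split=> //; exists C, D].
apply: ub_le_sup.
  by exists 1 => _ [E' [pi' [b' [_ _ _ ->]]]]; apply: compression_le1.
exists E, pi, b; split=> //; exists C, D; split=> // g.
by case/andP: (bP g).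
Qed.

(** * Two-sided norm bounds for the direct sum cocycle *)

Section DsumCompression.
Variables (R : realType) (G H : groupType) (S SG : seq G) (SH : seq H).
Hypotheses (S_gen : generates S) (SG_gen : generates SG)
  (SH_gen : generates SH).
Variables (E : hilbertSpace R) (pi : G -> {linear E -> E}) (b : G -> E).
Hypotheses (pi_unitary : unitary_representation pi) (b_cocycle : cocycle pi b).
Variables (r0 C D : R).
Hypotheses (C_gt0 : 0 < C) (D_gt0 : 0 < D).
Hypothesis b_bounds : forall g, C^-1 * (word_length S g)%:R `^ r0 - D <=
  hnorm (b g) <= C * (word_length S g)%:R + D.

Local Notation lenG g := (word_length SG g)%:R.
Local Notation lenH h := (word_length SH h)%:R.
Local Notation len f := (wreath_sublength SG SH f)%:R.

(** The additive constant [D] is absorbed, since [b] vanishes at the identity and all other lengths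
    are at least 1. The bound can then be summed over supports of any size. *)
Lemma cocycle_linear_bound : exists2 K : R, 0 <= K &
  forall g, hnorm (b g) <= K * lenG g.
Proof.
have [M SM] := word_length_lipschitz SG_gen S_gen.
exists (C * M%:R + D).
  by rewrite addr_ge0 ?mulr_ge0 ?(ltW C_gt0) ?(ltW D_gt0).
move=> g; have [->|g1] := eqVneq g 1%g.
  by rewrite (cocycle1 pi_unitary b_cocycle) word_length1 mulr0 /hnorm normr0.
have /andP[_ /le_trans->//] := b_bounds g.
rewrite mulrDl lerD//.
  by rewrite -mulrA ler_pM2l// -natrM ler_nat.
by rewrite ler_peMr ?(ltW D_gt0)// ler1n word_length_gt0.
Qed.

(** Squaring the lower bound on [b] doubles the exponent. The summand 2 is the least value of the
    weight term [2 (1 + |h|)]; it absorbs the contribution of [D]. *)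
Lemma cocycle_power_bound r : 0 < r -> r <= r0 -> exists2 c : R, 0 <= c &
  forall g, lenG g `^ (2 * r) <= c * (hnorm (b g) ^+ 2 + 2).
Proof.
move=> r_gt0 r_le.
have [M SM] := word_length_lipschitz S_gen SG_gen.
(* The power of [M] bounds [SG]-length by [S]-length; the rest comes from [C^2 (x + D)^2 <= 2 C^2 (1
   + D^2) (x^2 + 2)]. *)
exists (M%:R `^ (2 * r) * (2 * C ^+ 2 * (1 + D ^+ 2))).
  by rewrite !mulr_ge0 ?powR_ge0 ?addr_ge0 ?sqr_ge0 ?(ltW C_gt0).
move=> g; have r2 : 0 < 2 * r by rewrite mulr_gt0.
apply: (@le_trans _ _ (M%:R `^ (2 * r) * (word_length S g)%:R `^ (2 * r))).
  rewrite -powRM// ge0_ler_powR ?nnegrE ?mulr_ge0// ?(ltW r_gt0)//.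
  by rewrite -natrM ler_nat.
rewrite -mulrA; apply: ler_wpM2l; first exact: powR_ge0.
(* Comparing the exponents [r <= r0] requires a base at least 1, so length 0 is set apart; its power
   is 0 because [2 * r] is positive. *)
have [->|S0] := posnP (word_length S g).
  by rewrite powR0 ?gt_eqF// !mulr_ge0 ?addr_ge0 ?sqr_ge0 ?(ltW C_gt0).
have lenr : (word_length S g)%:R `^ r <= C * (hnorm (b g) + D).
  apply: (@le_trans _ _ ((word_length S g)%:R `^ r0)).
    by rewrite ler_powR// ler1n.
  rewrite mulrC -ler_pdivrMr// mulrC -lerBlDr.
  by case/andP: (b_bounds g).
rewrite mulrC powRrM powR_mulrn ?powR_ge0//.
have b0 := hnorm_ge0 (b g).
apply: (@le_trans _ _ ((C * (hnorm (b g) + D)) ^+ 2)).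
  rewrite lerXn2r// nnegrE ?powR_ge0// mulr_ge0 ?addr_ge0//.
  - exact: ltW.
  - exact: ltW.
set x := hnorm (b g) in b0 *.
rewrite exprMn; have -> : 2 * C ^+ 2 * (1 + D ^+ 2) * (x ^+ 2 + 2) =
    C ^+ 2 * (2 * (1 + D ^+ 2) * (x ^+ 2 + 2)) by ring.
apply: ler_wpM2l; first exact: sqr_ge0.
have := sqr_ge0 (x - D); have := sqr_ge0 x; have := sqr_ge0 D.
have := mulr_ge0 (sqr_ge0 x) (sqr_ge0 D); nra.
Qed.

Lemma dsum_compression_ge r : 0 < r -> r <= r0 -> 2 * r <= 1 ->
  r <= equivariant_compression (fun f : dsum H G => len f : R).
Proof.
move=> r_gt0 r_le r_le1; have r2 : 0 < 2 * r <= 1 by rewrite mulr_gt0.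
have [K K0 bK] := cocycle_linear_bound.
have [c c0 bc] := cocycle_power_bound r_gt0 r_le.
(* The squared weight [1 + |h|] is large enough to control [(2 |h|)^(2 r) <= 1 + 2 |h|], and small
   enough to sum to order [n^2] over at most [n] support points of length at most [n]. *)
have [E' [pi' [b' [pi'_unitary b'_cocycle b'E]]]] :=
  dsum_cocycleP pi_unitary b_cocycle (fun h : H => Num.sqrt (1 + lenH h)).
have {b'E} b'E f : hnorm (b' f) ^+ 2 =
    \sum_(h <- finsupp f) (hnorm (b (f h)) ^+ 2 + 2 * (1 + lenH h)).
  rewrite b'E; apply: eq_bigr => h _.
  by rewrite sqr_sqrtr// addr_ge0.
(* In [c + 1], the [c] pays for the values [f h] and the 1 for the positions [h]. *)
have lower f : len f `^ r <= Num.sqrt (c + 1) * hnorm (b' f).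
  rewrite -(@ler_pXn2r _ 2)// ?nnegrE ?powR_ge0 ?mulr_ge0 ?sqrtr_ge0 ?hnorm_ge0//.
  rewrite exprMn sqr_sqrtr ?addr_ge0// b'E mulr_sumr.
  rewrite -powR_mulrn ?powR_ge0// -powRrM mulrC.
  have suppP x : x \notin finsupp f -> f x = 1%g.
    by move=> xf; rewrite /dsum_app fsfun_dflt.
  have := wreath_sublength_le SG_gen SH_gen suppP.
  rewrite -(ler_nat R) natr_sum => f_le.
  apply: (@le_trans _ _ ((\sum_(h <- finsupp f)
      (word_length SG (f h) + 2 * word_length SH h)%:R) `^ (2 * r))).
    rewrite ge0_ler_powR ?nnegrE ?sumr_ge0//.
    by case/andP: r2 => /ltW.
  apply: le_trans (powR_sum_le _ _ r2) _ => //.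
  apply: ler_sum => h _; rewrite natrD natrM.
  apply: le_trans (powRD_le _ _ r2) _; rewrite ?mulr_ge0//.
  have h1 := bc (f h).
  have h2 : (2 * lenH h) `^ (2 * r) <= 1 + 2 * lenH h :> R.
    by apply: powR_le1D; rewrite ?mulr_ge0.
  have h3 : 0 <= lenH h :> R by [].
  have h4 := sqr_ge0 (hnorm (b (f h))); have h5 := mulr_ge0 c0 h3.
  move: h1 h2 h3 h4 h5.
  set y := lenH h; set x := hnorm _ ^+ 2; nra.
have upper f : hnorm (b' f) <= (K + 2) * (len f + 1).
  rewrite -(@ler_pXn2r _ 2)// ?nnegrE ?hnorm_ge0 ?mulr_ge0 ?addr_ge0//.
  rewrite b'E; set n := wreath_sublength SG SH f.
  (* Exhibiting some word for [f] shows that [n] is an attained length and not the default 0. *)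
  have n_ball : in_word_ball (wreath_gens SG SH) n (Wreath f 1%g).
    apply/word_lengthP/(in_word_ball_dsum SG_gen SH_gen (s := finsupp f)).
    by move=> x xf; rewrite /dsum_app fsfun_dflt.
  have [_ /= supp_n sum_n] := wreath_ball_bounds SG_gen SH_gen n_ball.
  have sum_nR : \sum_(h <- finsupp f) (lenG (f h) : R) <= n%:R.
    by rewrite -natr_sum ler_nat sum_n.
  have n0 : 0 <= n%:R :> R by [].
  (* Each summand is at most [(K^2 n + 2 (1 + n)) |f h|], as [1 <= |f h| <= n] and [|h| <= n] on the
     support; the lengths [|f h|] add up to at most [n]. *)
  apply: (@le_trans _ _ ((K ^+ 2 * n%:R + 2 * (1 + n%:R)) * n%:R)); last first.
    have := mulr_ge0 n0 n0; have := mulr_ge0 K0 n0.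
    have := mulr_ge0 (mulr_ge0 K0 n0) n0; have := mulr_ge0 K0 K0.
    have := mulr_ge0 (mulr_ge0 K0 K0) n0.
    rewrite !expr2; move: (n%:R : R) n0 => x *; nra.
  have coef0 : 0 <= K ^+ 2 * n%:R + 2 * (1 + n%:R) :> R.
    by rewrite addr_ge0 ?mulr_ge0 ?sqr_ge0 ?addr_ge0.
  apply: le_trans (ler_wpM2l coef0 sum_nR); rewrite mulr_sumr.
  rewrite big_seq [leRHS]big_seq; apply: ler_sum => h hf.
  have fh1 : f h != 1%g by rewrite -mem_finsupp.
  have lenG1 : 1 <= lenG (f h) :> R by rewrite ler1n word_length_gt0.
  have lenGn : lenG (f h) <= n%:R :> R.
    by have := sum_n [fset h]%fset; rewrite big_seq_fset1 ler_nat.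
  have lenHn : lenH h <= n%:R :> R by rewrite ler_nat supp_n.
  rewrite [leRHS]mulrDl; apply: lerD.
    apply: (@le_trans _ _ ((K * lenG (f h)) ^+ 2)).
      by rewrite lerXn2r ?nnegrE ?hnorm_ge0// mulr_ge0.
    rewrite exprMn -[leRHS]mulrA ler_wpM2l ?sqr_ge0// expr2.
    by rewrite ler_wpM2r.
  rewrite -mulrA ler_pM2l//; apply: (@le_trans _ _ (1 + n%:R)).
    by rewrite lerD2l.
  by rewrite ler_peMr ?addr_ge0.
(* The same constant occurs inverted in the lower bound and as the slope of the upper one, so it has
   to dominate both [Num.sqrt (c + 1)] and [K + 2]. *)
have C0 : 0 < Num.sqrt (c + 1) + K + 2.
  by rewrite ltr_wpDl// addr_ge0 ?sqrtr_ge0.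
apply: (@equivariant_compression_ge _ _ _ _ pi' b' _
  (Num.sqrt (c + 1) + K + 2) (K + 2)) => //.
- by rewrite (ltW r_gt0) /=; lra.
- by rewrite ltr_wpDl.
move=> f; have b0 := hnorm_ge0 (b' f); apply/andP; split.
  rewrite lerBlDr; apply: (@le_trans _ _ (hnorm (b' f))); last first.
    by rewrite lerDl addr_ge0.
  rewrite mulrC ler_pdivrMr// mulrC; apply: le_trans (lower f) _.
  by rewrite ler_wpM2r// -addrA lerDl addr_ge0.
apply: le_trans (upper f) _; rewrite mulrDr mulr1 lerD2r ler_wpM2r//.
by rewrite -addrA lerDr sqrtr_ge0.
Qed.

End DsumCompression.

Theorem theorem1p5 (R : realType) (G H : groupType)
    (S SG : seq G) (SH : seq H) (d : R) :
  generates S -> generates SG -> generates SH ->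
  polynomial_growth H d -> 1 <= d ->
  let alpha : R := fg_equivariant_compression R S in
  alpha / (1 + F alpha d + 2 * alpha * (1 + d)) <=
  equivariant_compression
    (fun f : dsum H G => (wreath_sublength SG SH f)%:R : R).
Proof.
move=> S_gen SG_gen SH_gen _ d1; lazy zeta.
set alpha := fg_equivariant_compression R S.
have alpha_ge0 : 0 <= alpha.
  by apply: sup_ge0 => _ [E [pi [b [_ _ _ ->]]]]; apply: compression_ge0.
have F_ge0 : 0 <= F alpha d.
  rewrite /F; case: ifP => // alpha2.
  by rewrite mulr_ge0 ?subr_ge0// (le_trans _ d1).
(* For [alpha = 0] the bound is 0. A positive [alpha] guarantees that there are cocycles to start
   from. *)
move: alpha_ge0; rewrite le_eqVlt => /predU1P[<-|alpha_gt0].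
  rewrite mul0r; apply: sup_ge0 => _ [E [pi [b [_ _ _ ->]]]].
  exact: compression_ge0.
have ad : alpha <= alpha * d by rewrite ler_peMr// ltW.
(* [F] is nonnegative and [d >= 1], so [2 alpha (1 + d)] already gives [4 alpha]. This places
   [alpha / den] below [1 / 2] and strictly below [alpha]. *)
set den := (_ + _ + _); have den_gt : 1 + 4 * alpha <= den by rewrite /den; lra.
have den_gt0 : 0 < den by lra.
have r_gt0 : 0 < alpha / den by rewrite divr_gt0.
have r_le : 2 * (alpha / den) <= 1.
  by rewrite mulrA ler_pdivrMr// mul1r; lra.
have r_lt : alpha / den < alpha.
  by rewrite ltr_pdivrMr// ltr_pMr//; lra.
(* The strict inequality passes through both suprema: first to a cocycle of compression above
   [alpha / den], then to one of its admissible exponents [r0]. *)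
have [_ [E [pi [b [pi_unitary b_cocycle _ ->]]]] r_lt'] :=
  gt0_sup_gt r_gt0 r_lt.
have [r0 [_ [C [D [C0 D0 b_bounds]]]] /ltW r_le0] := gt0_sup_gt r_gt0 r_lt'.
exact: (dsum_compression_ge S_gen SG_gen SH_gen pi_unitary b_cocycle
  C0 D0 b_bounds).
Qed.
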